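(* Let $\pi:L\to G$ be a surjective homomorphism from a loop $L$ onto a group $G$, and suppose that the kernel $N:=\ker\pi$ is finite. (i) If $K\ge 1$ and $A\subseteq L$ is a $K$-approximate subloop of $L$, then $\pi(A)$ is a $(K|N|)$-approximate subgroup of $G$, i.e. $1\in\pi(A)$, $\pi(A)=\pi(A)^{-1}$ and $|\pi(A)^3|\le K|N|\,|\pi(A)|$. (ii) If $L_0\ge 1$ and $B\subseteq G$ is an $L_0$-approximate subgroup of $G$, then $\pi^{-1}(B)$ is an $L_0$-approximate subloop of $L$.
   Context: A loop is a set with a binary operation having a two-sided identity $1$ such that for all $a,b$ the equations $ax=b$ and $ya=b$ have unique solutions. For subsets $X,Y$ of a loop, $XY=\{xy:x\in X,y\in Y\}$. For a finite subset $A$ of a loop, $A^{\langle 3\rangle}:=(AA)A\cup A(AA)$. For a real $K\ge 1$, a finite subset $A$ of a loop is a $K$-approximate subloop if $1\in A$, $A=A^{-1}$ and $|A^{\langle 3\rangle}|\le K|A|$. For a real $L_0\ge1$, an $L_0$-approximate subgroup of a group is a finite set $B$ with $1\in B$, $B=B^{-1}$ and $|B^3|\le L_0|B|$, where $B^3=BBB$. The kernel of $\pi$ is $\pi^{-1}(1)$. *)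

(* Defs.v *)
From HB Require Import structures.
From mathcomp Require Import all_boot all_order all_algebra.
From mathcomp Require Import all_classical all_reals.
From mathcomp Require Import finmap.

Set Implicit Arguments.
Unset Strict Implicit.
Unset Printing Implicit Defensive.

Import Order.TTheory GRing.Theory Num.Theory.

Local Open Scope classical_set_scope.
Local Open Scope ring_scope.

HB.mixin Record UMagma_isLoop L of UMagma L := {
  loop_ldiv : forall a b : L, exists! x : L, (a * x)%g = b;
  loop_rdiv : forall a b : L, exists! y : L, (y * a)%g = b
}.

#[short(type="loopType")]
HB.structure Definition Loop := {L of UMagma_isLoop L & UMagma L}.

Definition prodset (M : magmaType) (X Y : set M) : set M :=
  [set (x * y)%g | x in X & y in Y].

Definition kernel (L : loopType) (G : groupType) (pi : L -> G) : set L :=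
  pi @^-1` [set 1%g].

(* Only meaningful for finite sets: [fset_set X] is empty when X is infinite. *)
Definition setcard (T : choiceType) (X : set T) : nat := #|` fset_set X|.

(* In a loop the left and right inverses of an element exist but may differ;
   the inverse of a set collects both. For a finite A, the equation
   [A = loop_invset A] holds iff A is closed under right inverses, iff A is
   closed under left inverses: both inversions are injective, and they are
   inverse to each other. *)
Definition loop_invset (L : loopType) (A : set L) : set L :=
  [set y | exists2 x, A x & (x * y = 1)%g \/ (y * x = 1)%g].

Definition loop_triple (L : loopType) (A : set L) : set L :=
  prodset (prodset A A) A `|` prodset A (prodset A A).

Definition approximate_subloop (R : realType) (L : loopType) (K : R)
    (A : set L) : Prop :=
  [/\ 1 <= K, finite_set A, A 1%g, A = loop_invset A
    & (setcard (loop_triple A))%:R <= K * (setcard A)%:R].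

Definition approximate_subgroup (R : realType) (G : groupType) (K : R)
    (B : set G) : Prop :=
  [/\ 1 <= K, finite_set B, B 1%g, B = [set (x^-1)%g | x in B]
    & (setcard (prodset (prodset B B) B))%:R <= K * (setcard B)%:R].

(* Main.v *)
Require Import Defs.
From mathcomp Require Import all_boot all_order all_algebra.
From mathcomp Require Import all_classical all_reals.
From mathcomp Require Import finmap.

(** Left translation by an element of [L] over [g] is a bijection from the
    kernel [N] onto the fibre over [g] (division is all that is needed, not
    associativity), so [|pi^-1(C)| = |C| |N|] for every finite [C]. Both bounds
    then follow from [pi(A)^3 = pi((AA)A)], [A <= pi^-1(pi(A))] and
    [(pi^-1(B))^<3> <= pi^-1(B^3)]. *)

Import Order.TTheory GRing.Theory Num.Theory.

Local Open Scope classical_set_scope.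
Local Open Scope ring_scope.

Lemma setcard_subset (T : choiceType) (X Y : set T) :
  finite_set Y -> X `<=` Y -> (setcard X <= setcard Y)%N.
Proof.
move=> finY XY; apply: fsubset_leq_card; rewrite -fset_set_sub//.
exact: sub_finite_set finY.
Qed.

Lemma setcard_image_le (T U : choiceType) (f : T -> U) (X : set T) :
  finite_set X -> (setcard (f @` X) <= setcard X)%N.
Proof.
by move=> finX; rewrite /setcard fset_set_image//; apply: leq_imfset_card.
Qed.

Lemma setcard_image_inj (T U : choiceType) (f : T -> U) (X : set T) :
  finite_set X -> {in X &, injective f} -> setcard (f @` X) = setcard X.
Proof.
move=> finX injf; apply/fcard_eq => //; first exact: finite_image.
exact: inj_card_eq.
Qed.

(** The finite product and the list of all pairs are duplicate-free with the same members, hence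
    permutations of each other. *)
Lemma setcardX (T U : choiceType) (X : set T) (Y : set U) :
  finite_set X -> finite_set Y ->
  setcard (X `*` Y) = (setcard X * setcard Y)%N.
Proof.
move=> finX finY; rewrite /setcard fset_setX// -(size_allpairs pair).
apply/perm_size/uniq_perm => //.
  by apply: allpairs_uniq => // -[x y] [x' y'].
move=> [x y]; rewrite in_fsetM /=; apply/andP/allpairsP => [[Xx Yy]|].
  by exists (x, y).
by move=> [[x' y'] /= [Xx Yy [-> ->]]].
Qed.

Section Prodset.
Context (M : magmaType).
Implicit Types X Y : set M.

Lemma prodsetE X Y : prodset X Y = (fun u => u.1 * u.2)%g @` (X `*` Y).
Proof.
apply/seteqP; split=> [_ [x Xx [y Yy <-]]|_ [[x y] [Xx Yy] <-]].
  by exists (x, y).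
by exists x => //; exists y.
Qed.

Lemma finite_prodset X Y :
  finite_set X -> finite_set Y -> finite_set (prodset X Y).
Proof.
by move=> finX finY; rewrite prodsetE; apply/finite_image/finite_setX.
Qed.

Lemma prodset_image (M' : magmaType) (f : {multiplicative M -> M'}) X Y :
  prodset (f @` X) (f @` Y) = f @` prodset X Y.
Proof.
apply/seteqP; split=> [_ [_ [x Xx <-] [_ [y Yy <-] <-]]|].
  by exists (x * y)%g; [exists x => //; exists y | rewrite gmulfM].
move=> _ [_ [x Xx [y Yy <-]] <-].
by exists (f x); [exists x | exists (f y); [exists y | rewrite gmulfM]].
Qed.

Lemma prodset_preimage_subset (M' : magmaType) (f : {multiplicative M -> M'})
    (X Y : set M') :
  prodset (f @^-1` X) (f @^-1` Y) `<=` f @^-1` prodset X Y.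
Proof.
move=> _ [x Xx [y Yy <-]]; rewrite /preimage /= gmulfM.
by exists (f x) => //; exists (f y).
Qed.

Lemma prodset_subset X X' Y Y' :
  X `<=` X' -> Y `<=` Y' -> prodset X Y `<=` prodset X' Y'.
Proof.
by move=> XX' YY' _ [x /XX' Xx [y /YY' Yy <-]]; exists x => //; exists y.
Qed.

End Prodset.

Lemma prodsetA (G : groupType) (X Y Z : set G) :
  prodset X (prodset Y Z) = prodset (prodset X Y) Z.
Proof.
apply/seteqP; split=> [_ [x Xx [_ [y Yy [z Zz <-]] <-]]|].
  by exists (x * y)%g; [exists x => //; exists y | exists z; rewrite ?mulgA].
move=> _ [_ [x Xx [y Yy <-]] [z Zz <-]].
by exists x => //; exists (y * z)%g; [exists y => //; exists z | rewrite mulgA].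
Qed.

Lemma loop_mulgI (L : loopType) (x : L) : injective (fun y : L => x * y)%g.
Proof.
move=> y z; have [w [_ wuniq]] := loop_ldiv x (x * z)%g.
by move=> /= /wuniq <-; apply: wuniq.
Qed.

Lemma finite_loop_triple (L : loopType) (A : set L) :
  finite_set A -> finite_set (loop_triple A).
Proof.
by move=> finA; rewrite finite_setU; split; do ?apply: finite_prodset.
Qed.

Section LoopToGroup.
Context (L : loopType) (G : groupType) (pi : {multiplicative L -> G}).

(** [pi] is only given as compatible with products; [pi 1] is idempotent, and cancellation in [G]
    forces it to be the identity. *)
Lemma loop_hom1 : pi 1%g = 1%g.
Proof. by apply: (mulgI (pi 1%g)); rewrite -gmulfM !mulg1. Qed.

(** One-sided inverses in a group are two-sided, so left and right inverses of an element of [L],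
    which may differ, have the same image. *)
Lemma loop_hom_inv (x y : L) : (x * y = 1)%g -> (pi y = (pi x)^-1)%g.
Proof.
by move=> xy1; apply/esym/mulg1_eq; rewrite -gmulfM xy1 loop_hom1.
Qed.

Lemma image_loop_invset (A : set L) :
  pi @` loop_invset A = [set x^-1%g | x in pi @` A].
Proof.
apply/seteqP; split=> [_ [y [x Ax xy] <-]|_ [_ [x Ax <-] <-]].
  exists (pi x); first by exists x.
  by case: xy => /loop_hom_inv ->; rewrite ?invgK.
have [y [xy _]] := loop_ldiv x 1%g.
by exists y; [exists x => //; left | apply: loop_hom_inv].
Qed.

Lemma preimage_loop_invset (B : set G) :
  loop_invset (pi @^-1` B) = pi @^-1` [set x^-1%g | x in B].
Proof.
apply/seteqP; split=> [y [x Bx xy]|y [g Bg gy]].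
  by exists (pi x) => //; case: xy => /loop_hom_inv ->; rewrite ?invgK.
(* The witness is the right inverse of [y]; it lies over the inverse of [pi y], which is [g]. *)
have [x [yx _]] := loop_ldiv y 1%g.
exists x; last by right.
by rewrite /preimage /= (loop_hom_inv _ _ yx) -gy invgK.
Qed.

(** Associativity in [G] identifies the images of the two bracketings; only the second inclusion has
    to be rebracketed. *)
Lemma loop_triple_preimage_subset (B : set G) :
  loop_triple (pi @^-1` B) `<=` pi @^-1` prodset (prodset B B) B.
Proof.
have BB := @prodset_preimage_subset _ _ pi B B.
rewrite /loop_triple subUset -{2}prodsetA; split;
  by apply: subset_trans (@prodset_preimage_subset _ _ _ _ _);
     apply: prodset_subset.
Qed.

Hypotheses (pi_surj : forall g : G, exists x : L, pi x = g)
  (ker_fin : finite_set (kernel pi)).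

Lemma preimage_kernelE (s : G -> L) (C : set G) : cancel s pi ->
  pi @^-1` C = (fun u => s u.1 * u.2)%g @` (C `*` kernel pi).
Proof.
move=> sK; apply/seteqP; split=> [x Cx|_ [[g n] [/= Cg Nn] <-]].
  (* The kernel component of [x] is its left quotient by the chosen point of its fibre; cancelling
     [pi x] in [G] shows that [n] lies over 1. *)
  have [n [snx _]] := loop_ldiv (s (pi x)) x.
  exists (pi x, n) => //; split=> //=.
  by apply: (mulgI (pi x)); rewrite -[in LHS](sK (pi x)) -gmulfM snx mulg1.
by rewrite /preimage /= gmulfM sK Nn mulg1.
Qed.

Lemma finite_preimage_loop (C : set G) :
  finite_set C -> finite_set (pi @^-1` C).
Proof.
move=> finC; have [s sK] := choice pi_surj.
by rewrite (preimage_kernelE _ _ sK); apply/finite_image/finite_setX.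
Qed.

Lemma setcard_preimage_loop (C : set G) : finite_set C ->
  setcard (pi @^-1` C) = (setcard C * setcard (kernel pi))%N.
Proof.
move=> finC; have [s sK] := choice pi_surj.
rewrite (preimage_kernelE _ _ sK) setcard_image_inj ?setcardX//.
  exact: finite_setX.
move=> [g n] [h m]; rewrite !in_setE => -[/= _ Nn] [/= _ Nm] eq_gh.
(* Injectivity: applying [pi] recovers the base point, then left cancellation in [L] recovers the
   kernel component. *)
have gh : g = h.
  by have := congr1 pi eq_gh; rewrite !gmulfM !sK Nn Nm !mulg1.
by rewrite gh in eq_gh *; rewrite (loop_mulgI _ _ _ _ eq_gh).
Qed.

(** This keeps the constant [K * |N|] at least 1, as the definition of an approximate subgroup
    demands. *)
Lemma setcard_kernel_gt0 : (0 < setcard (kernel pi))%N.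
Proof.
rewrite cardfs_gt0; apply/fset0Pn; exists 1%g.
by rewrite in_fset_set// in_setE; apply: loop_hom1.
Qed.

End LoopToGroup.

Theorem proposition4p1 (R : realType) (L : loopType) (G : groupType)
    (pi : {multiplicative L -> G})
    (pi_surj : forall g : G, exists x : L, pi x = g)
    (ker_fin : finite_set (kernel pi)) :
  (forall (K : R) (A : set L), 1 <= K ->
     approximate_subloop K A ->
     approximate_subgroup (K * (setcard (kernel pi))%:R) (pi @` A))
  /\
  (forall (L0 : R) (B : set G), 1 <= L0 ->
     approximate_subgroup L0 B ->
     approximate_subloop L0 (pi @^-1` B)).
Proof.
split=> [K A K1 [_ finA A1 AV cardA]|L0 B L1 [_ finB B1 BV cardB]].
  have fpiA : finite_set (pi @` A) by apply: finite_image.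
  split=> //.
  - by rewrite mulr_ege1// ler1n setcard_kernel_gt0.
  - by exists 1%g => //; apply: loop_hom1.
  - by rewrite -image_loop_invset -AV.
  rewrite !prodset_image -mulrA -natrM.
  (* The upper half comes first: [A] lies in the preimage of [pi(A)], so |A| <= |pi(A)| |N|. *)
  apply: (@le_trans _ _ (K * (setcard A)%:R)); last first.
    rewrite ler_pM2l ?(lt_le_trans ltr01)// ler_nat mulnC.
    rewrite -setcard_preimage_loop//; apply: setcard_subset.
      exact: finite_preimage_loop.
    exact: preimage_image.
  (* The lower half: |pi((AA)A)| <= |(AA)A| <= |A^<3>| <= K|A|. *)
  apply: le_trans cardA; rewrite ler_nat.
  apply: leq_trans (setcard_image_le _ _ _ _ _) _.
    by do 2?apply: finite_prodset.
  by apply: setcard_subset; [apply: finite_loop_triple | apply: subsetUl].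
split=> //.
- exact: finite_preimage_loop.
- by rewrite /preimage /= loop_hom1.
- by rewrite preimage_loop_invset -BV.
have finB3 : finite_set (prodset (prodset B B) B).
  by do 2?apply: finite_prodset.
apply: (@le_trans _ _ (setcard (pi @^-1` prodset (prodset B B) B))%:R).
  rewrite ler_nat; apply: setcard_subset; first exact: finite_preimage_loop.
  exact: loop_triple_preimage_subset.
(* Both preimages acquire the same factor |N|, so the bound for [B] passes to its preimage with [L0]
   unchanged. *)
rewrite (setcard_preimage_loop _ _ _ pi_surj ker_fin _ finB3).
rewrite (setcard_preimage_loop _ _ _ pi_surj ker_fin _ finB).
by rewrite (natrM R (setcard B)) mulrA natrM; apply: ler_wpM2r.
Qed.
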